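(* Let $X,Y,Z,W$ be normed spaces and let $f:X\times Y\times Z\longrightarrow W$ be a bounded tri-linear map. Then (1) $f$ is Aron-Berner regular if and only if $f^{t****s}=f^{****}=f^{s****t}$; (2) $f$ is Aron-Berner regular if and only if $f^{i****i}=f^{j****j}=f^{r****r}$.
   Context: For a normed space $E$, $E^*$ is its (continuous) dual, $E^{**}$ its bidual, and $\langle\cdot,\cdot\rangle$ is the duality pairing (written in either order). Adjoint: for normed spaces $A,B,C,D$ and a bounded tri-linear map $g:A\times B\times C\to D$, the adjoint is the bounded tri-linear map $g^*:D^*\times A\times B\to C^*$ given by $\langle g^*(d^*,a,b),c\rangle=\langle d^*,g(a,b,c)\rangle$. Iterating, $g^{**}=(g^* )^*:C^{**}\times D^*\times A\to B^*$, $g^{***}=(g^{**})^*:B^{**}\times C^{**}\times D^*\to A^*$, and $g^{****}=(g^{***})^*:A^{**}\times B^{**}\times C^{**}\to D^{**}$. Flip maps: for a bounded tri-linear $g:A\times B\times C\to D$, define the bounded tri-linear maps $g^i:B\times A\times C\to D$, $g^i(b,a,c)=g(a,b,c)$; $g^j:A\times C\times B\to D$, $g^j(a,c,b)=g(a,b,c)$; $g^r:C\times B\times A\to D$, $g^r(c,b,a)=g(a,b,c)$; $g^t:C\times A\times B\to D$, $g^t(c,a,b)=g(a,b,c)$; $g^s:B\times C\times A\to D$, $g^s(b,c,a)=g(a,b,c)$. Superscripts are applied successively from left to right, e.g. $f^{t****s}=((f^t)^{****})^s$. The six natural extensions of $f:X\times Y\times Z\to W$ are the maps $f^{****},f^{i****i},f^{j****j},f^{r****r},f^{t****s},f^{s****t}:X^{**}\times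 Y^{**}\times Z^{**}\to W^{**}$. The map $f$ is called Aron-Berner regular if all six natural extensions are equal: $f^{i****i}=f^{j****j}=f^{r****r}=f^{****}=f^{t****s}=f^{s****t}$. *)

(* Defs.v *)
From HB Require Import structures.
From mathcomp Require Import all_boot all_order all_algebra.
From mathcomp Require Import complex.
From mathcomp Require Import boolp classical_sets functions reals topology.
From mathcomp Require Import normedtype.
From mathcomp Require Import ring.

Set Implicit Arguments.
Unset Strict Implicit.
Unset Printing Implicit Defensive.

Import Order.TTheory GRing.Theory Num.Theory.
Import numFieldNormedType.Exports.

Local Open Scope classical_set_scope.
Local Open Scope ring_scope.

Variant scalar_kind := RealScalars | ComplexScalars.

(* A [normedModType (scalar_field R k)] is a real or complex normed space;
   norms take their values among the nonnegative (hence real) scalars. *)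
Definition scalar_field (R : realType) (k : scalar_kind) : numFieldType :=
  match k with
  | RealScalars => R
  | ComplexScalars => R[i]
  end.

Lemma real_supremum_ex (R : realType) (A : set R) (M : R) :
  A !=set0 -> ubound A M -> supremums A !=set0.
Proof.
move=> A0 AM; exists (sup A); split=> [x Ax|y yA].
  by apply: (@ub_le_sup _ A) => //; exists M.
exact: ge_sup.
Qed.

Lemma complex_supremum_ex (R : realType) (A : set R[i]) (M : R[i]) :
  A !=set0 -> (forall x, A x -> 0 <= x) -> ubound A M -> supremums A !=set0.
Proof.
move=> [x0 Ax0] A0 AM.
have imA x : A x -> complex.Im x = 0.
  by move=> /A0; rewrite lecE => /andP[/eqP].
have [||s [ubs lbs]] := @real_supremum_ex R [set complex.Re x | x in A]
    (complex.Re M).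
- by exists (complex.Re x0), x0.
- by move=> _ [x Ax <-]; have := AM _ Ax; rewrite lecE => /andP[].
exists (Complex s 0); split=> [x Ax|y yA].
  by rewrite lecE /= (imA _ Ax) eqxx /=; apply: ubs; exists x.
have := yA _ Ax0; rewrite !lecE /= (imA _ Ax0) => /andP[-> _] /=.
by apply: lbs => _ [x Ax <-]; have := yA _ Ax; rewrite lecE => /andP[].
Qed.

Lemma scalar_supremum_ex (R : realType) (k : scalar_kind)
    (A : set (scalar_field R k)) (M : scalar_field R k) :
  A !=set0 -> (forall x, A x -> 0 <= x) -> ubound A M -> supremums A !=set0.
Proof.
by case: k A M => A M A0 Age0; [exact: real_supremum_ex|exact: complex_supremum_ex].
Qed.

Section Dual.
Context {R : realType} {k : scalar_kind}.
Local Notation K := (scalar_field R k).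
Variable E : normedModType K.

Definition dual_pred : {pred E -> K^o} :=
  fun f => `[< linear f /\ continuous f >].

Lemma dual_submod_closed : submod_closed dual_pred.
Proof.
split=> [|a f g /asboolP[lf cf] /asboolP[lg cg]]; apply/asboolP; split.
- by move=> a u v /=; rewrite scaler0 addr0.
- by move=> x; exact: cvg_cst.
- move=> b u v; rewrite !fctE /= lf lg !scalerDr !scalerA mulrC -!addrA.
  by congr (_ + _); rewrite addrCA.
- by move=> x; apply: cvgD; [apply: cvgZl_tmp; exact: cf|exact: cg].
Qed.

HB.instance Definition _ :=
  GRing.isSubmodClosed.Build K (E -> K^o) dual_pred dual_submod_closed.

Record dual := Dual { dual_fun :> E -> K^o ; _ : dual_fun \in dual_pred }.

HB.instance Definition _ := [isSub for dual_fun].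
HB.instance Definition _ := [Choice of dual by <:].
HB.instance Definition _ := [SubChoice_isSubLmodule of dual by <:].

Implicit Types f g : dual.

Lemma dual_linear f : linear f.
Proof. by have /asboolP[] := valP f. Qed.

HB.instance Definition _ f :=
  GRing.isLinear.Build K E K^o *:%R (dual_fun f) (dual_linear f).

Lemma dual_continuous f : continuous f.
Proof. by have /asboolP[] := valP f. Qed.

Definition dual_norm f : K :=
  supremum 0 [set `|f x| | x in [set x : E | `|x| <= 1]].

Lemma dual_bounded f : exists2 M : K, 0 <= M & forall x, `|f x| <= M * `|x|.
Proof.
have fb : bounded_near f (nbhs (0 : E)).
  by apply: continuous_linear_bounded; exact: dual_continuous.
have [M M0 Mf] := pinfty_ex_gt0 ((linear_boundedP f).1 fb).
by exists M => //; exact: ltW.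
Qed.

Lemma dual_normP f :
  supremums [set `|f x| | x in [set x : E | `|x| <= 1]] (dual_norm f).
Proof.
have [M M0 Mf] := dual_bounded f.
rewrite /dual_norm /supremum ifF; last first.
  by apply/negbTE/set0P; exists `|f 0|, 0 => //=; rewrite normr0.
case: xgetP => // noS.
have [||_ [x x1 <-]|s /noS//] := @scalar_supremum_ex R k
  [set `|f x| | x in [set x : E | `|x| <= 1]] M.
- by exists `|f 0|, 0 => //=; rewrite normr0.
- by move=> _ [x _ <-].
- by rewrite (le_trans (Mf x))// ler_piMr.
Qed.

Lemma dual_norm_ge0 f : 0 <= dual_norm f.
Proof.
apply: (le_trans (normr_ge0 (f 0))); apply: (dual_normP f).1.
by exists 0 => //=; rewrite normr0.
Qed.

Lemma dual_norm_le f (M : K) :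
  0 <= M -> (forall x, `|f x| <= M * `|x|) -> dual_norm f <= M.
Proof.
move=> M0 Mf; apply: (dual_normP f).2 => _ [x x1 <-].
by rewrite (le_trans (Mf x))// ler_piMr.
Qed.

Lemma ler_dual_norm f x : `|f x| <= dual_norm f * `|x|.
Proof.
have [->|x0] := eqVneq x 0; first by rewrite linear0 !normr0 mulr0.
have nx0 : 0 < `|x| by rewrite normr_gt0.
rewrite -ler_pdivrMr// mulrC -[`|x|^-1]ger0_norm ?invr_ge0// -normrZ -linearZ.
by apply: (dual_normP f).1; exists (`|x|^-1 *: x) => //=;
  rewrite normrZ normfV normr_id mulVf// gt_eqF.
Qed.

Lemma dual_ext f g : (forall x, f x = g x) -> f = g.
Proof. by move=> fg; apply/val_inj/funext. Qed.

Lemma dual_normD f g : dual_norm (f + g) <= dual_norm f + dual_norm g.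
Proof.
apply: dual_norm_le => [|x]; first by rewrite addr_ge0 ?dual_norm_ge0.
by rewrite mulrDl (le_trans (ler_normD _ _))// lerD ?ler_dual_norm.
Qed.

Lemma dual_normZ a f : dual_norm (a *: f) = `|a| * dual_norm f.
Proof.
have leZ b g : dual_norm (b *: g) <= `|b| * dual_norm g.
  apply: dual_norm_le => [|x]; first by rewrite mulr_ge0 ?dual_norm_ge0.
  by rewrite normrZ -mulrA ler_wpM2l ?ler_dual_norm.
apply/eqP; rewrite eq_le leZ /=.
have [->|a0] := eqVneq a 0; first by rewrite normr0 mul0r dual_norm_ge0.
by rewrite -ler_pdivlMl ?normr_gt0// -normfV (le_trans _ (leZ _ _))//
  scalerA mulVf// scale1r.
Qed.

Lemma dual_norm0_eq0 f : dual_norm f = 0 -> f = 0.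
Proof.
move=> f0; apply: dual_ext => x; apply/normr0_eq0/le_anti.
by rewrite normr_ge0 andbT (le_trans (ler_dual_norm _ _))// f0 mul0r.
Qed.

HB.instance Definition _ :=
  Lmodule_isNormed.Build K dual dual_normD dual_normZ dual_norm0_eq0.

End Dual.

Section Trilinear.
Context {R : realType} {k : scalar_kind}.
Local Notation K := (scalar_field R k).

Record bounded_trilinear (A B C D : normedModType K) := BoundedTrilinear {
  trilinear_fun :> A -> B -> C -> D ;
  trilinear_l : forall b c, linear (fun a => trilinear_fun a b c) ;
  trilinear_m : forall a c, linear (fun b => trilinear_fun a b c) ;
  trilinear_r : forall a b, linear (fun c => trilinear_fun a b c) ;
  trilinear_bounded : exists M : K, forall a b c,
    `|trilinear_fun a b c| <= M * `|a| * `|b| * `|c|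
}.

Lemma trilinear_bounded_ge0 (A B C D : normedModType K)
    (g : bounded_trilinear A B C D) :
  exists2 M : K, 0 <= M & forall a b c, `|g a b c| <= M * `|a| * `|b| * `|c|.
Proof.
have [M gM] := trilinear_bounded g; exists `|M| => // a b c.
rewrite (le_trans (real_ler_norm _))// ?normr_real// -[leRHS]ger0_norm; last first.
  by rewrite !mulr_ge0.
by rewrite !normrM !normr_id -[`|a|]normr_id -[`|b|]normr_id -[`|c|]normr_id
  -!normrM (le_trans (gM a b c))// real_ler_norm// ger0_real//
  (le_trans _ (gM a b c)).
Qed.

Lemma bounded_trilinear_ext (A B C D : normedModType K)
    (g h : bounded_trilinear A B C D) :
  (forall a b c, g a b c = h a b c) -> g = h.
Proof.
case: g h => [g gl gm gr gM] [h hl hm hr hM] /= gh.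
have {}gh : g = h by apply/funext => a; apply/funext => b; apply/funext.
by case: _ / gh in hl hm hr hM *; congr BoundedTrilinear; exact: Prop_irrelevance.
Qed.

Section Adjoint.
Variables A B C D : normedModType K.
Variable g : bounded_trilinear A B C D.

Let adjoint_val (d' : dual D) (a : A) (b : B) (c : C) : K^o := d' (g a b c).

Let adjoint_val_linear d' a b : linear (adjoint_val d' a b).
Proof. by move=> l u v; rewrite /adjoint_val trilinear_r linearP. Qed.

Lemma adjoint_subproof d' a b : adjoint_val d' a b \in @dual_pred R k C.
Proof.
have lin := adjoint_val_linear d' a b; apply/asboolP; split => //.
pose L : {linear C -> K^o} := HB.pack (adjoint_val d' a b)
  (GRing.isLinear.Build K C K^o *:%R (adjoint_val d' a b) lin).
suff : continuous L by [].
have [M M0 gM] := trilinear_bounded_ge0 g.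
pose N := `|d'| * (M * `|a| * `|b|).
have N0 : 0 <= N by rewrite !mulr_ge0.
apply/bounded_linear_continuous/bounded_funP => r; exists (N * r) => c cr.
rewrite (le_trans (ler_dual_norm _ _))// (le_trans _ (ler_wpM2l N0 cr))//.
by rewrite /N -[leRHS]mulrA; apply: ler_wpM2l (gM a b c); exact: dual_norm_ge0.
Qed.

Definition adjoint_fun (d' : dual D) (a : A) (b : B) : dual C :=
  Dual (adjoint_subproof d' a b).

Lemma adjoint_fun_l a b : linear (fun d' => adjoint_fun d' a b).
Proof. by move=> l u v; apply: dual_ext. Qed.

Lemma adjoint_fun_m d' b : linear (fun a => adjoint_fun d' a b).
Proof.
move=> l u v; apply: dual_ext => c.
by rewrite /= /adjoint_val trilinear_l linearP.
Qed.

Lemma adjoint_fun_r d' a : linear (fun b => adjoint_fun d' a b).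
Proof.
move=> l u v; apply: dual_ext => c.
by rewrite /= /adjoint_val trilinear_m linearP.
Qed.

Lemma adjoint_fun_bounded : exists M : K, forall d' a b,
  `|adjoint_fun d' a b| <= M * `|d'| * `|a| * `|b|.
Proof.
have [M M0 gM] := trilinear_bounded_ge0 g; exists M => d' a b.
apply: dual_norm_le => [|c]; first by rewrite !mulr_ge0.
apply: (le_trans (ler_dual_norm d' (g a b c))).
apply: (le_trans (ler_wpM2l (dual_norm_ge0 d') (gM a b c))).
by rewrite !mulrA [M * _]mulrC.
Qed.

Definition adjoint : bounded_trilinear (dual D) A B (dual C) :=
  BoundedTrilinear adjoint_fun_l adjoint_fun_m adjoint_fun_r
    adjoint_fun_bounded.

Lemma adjointE d' a b c : adjoint d' a b c = d' (g a b c).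
Proof. by []. Qed.

End Adjoint.

Section Flips.
Variables A B C D : normedModType K.
Variable g : bounded_trilinear A B C D.

Let permute_bounded (M : K) a b c : `|g a b c| <= M * `|a| * `|b| * `|c| ->
  [/\ `|g a b c| <= M * `|b| * `|a| * `|c|,
      `|g a b c| <= M * `|a| * `|c| * `|b|,
      `|g a b c| <= M * `|c| * `|b| * `|a|,
      `|g a b c| <= M * `|c| * `|a| * `|b| &
      `|g a b c| <= M * `|b| * `|c| * `|a|].
Proof.
by move=> gM; split; apply: (le_trans gM); rewrite le_eqVlt;
  apply/orP; left; apply/eqP; ring.
Qed.

Lemma flip_i_bounded : exists M : K, forall b a c,
  `|g a b c| <= M * `|b| * `|a| * `|c|.
Proof.
by have [M gM] := trilinear_bounded g; exists M => b a c;
  have [] := permute_bounded (gM a b c).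
Qed.

Lemma flip_j_bounded : exists M : K, forall a c b,
  `|g a b c| <= M * `|a| * `|c| * `|b|.
Proof.
by have [M gM] := trilinear_bounded g; exists M => a c b;
  have [] := permute_bounded (gM a b c).
Qed.

Lemma flip_r_bounded : exists M : K, forall c b a,
  `|g a b c| <= M * `|c| * `|b| * `|a|.
Proof.
by have [M gM] := trilinear_bounded g; exists M => c b a;
  have [] := permute_bounded (gM a b c).
Qed.

Lemma flip_t_bounded : exists M : K, forall c a b,
  `|g a b c| <= M * `|c| * `|a| * `|b|.
Proof.
by have [M gM] := trilinear_bounded g; exists M => c a b;
  have [] := permute_bounded (gM a b c).
Qed.

Lemma flip_s_bounded : exists M : K, forall b c a,
  `|g a b c| <= M * `|b| * `|c| * `|a|.
Proof.
by have [M gM] := trilinear_bounded g; exists M => b c a;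
  have [] := permute_bounded (gM a b c).
Qed.

Let gl b c := trilinear_l g b c.
Let gm a c := trilinear_m g a c.
Let gr a b := trilinear_r g a b.

Definition flip_i : bounded_trilinear B A C D :=
  @BoundedTrilinear B A C D (fun b a c => g a b c)
    (fun a c => gm a c) (fun b c => gl b c) (fun b a => gr a b) flip_i_bounded.

Definition flip_j : bounded_trilinear A C B D :=
  @BoundedTrilinear A C B D (fun a c b => g a b c)
    (fun c b => gl b c) (fun a b => gr a b) (fun a c => gm a c) flip_j_bounded.

Definition flip_r : bounded_trilinear C B A D :=
  @BoundedTrilinear C B A D (fun c b a => g a b c)
    (fun b a => gr a b) (fun c a => gm a c) (fun c b => gl b c) flip_r_bounded.

Definition flip_t : bounded_trilinear C A B D :=
  @BoundedTrilinear C A B D (fun c a b => g a b c)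
    (fun a b => gr a b) (fun c b => gl b c) (fun c a => gm a c) flip_t_bounded.

Definition flip_s : bounded_trilinear B C A D :=
  @BoundedTrilinear B C A D (fun b c a => g a b c)
    (fun c a => gm a c) (fun b a => gr a b) (fun b c => gl b c) flip_s_bounded.

End Flips.

Definition bidual (E : normedModType K) : normedModType K := dual (dual E).

Section Extensions.
Variables A B C D : normedModType K.

Definition adjoint4 (g : bounded_trilinear A B C D) :
    bounded_trilinear (bidual A) (bidual B) (bidual C) (bidual D) :=
  adjoint (adjoint (adjoint (adjoint g))).

End Extensions.

Section Regularity.
Variables X Y Z W : normedModType K.
Variable f : bounded_trilinear X Y Z W.

Local Notation extension :=
  (bounded_trilinear (bidual X) (bidual Y) (bidual Z) (bidual W)).

(* Superscripts act from left to right: [ext_ts] is f^{t****s}, that is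
   ((f^t)^{****})^s, and [ext_st] is f^{s****t}. *)
Definition ext_id : extension := adjoint4 f.
Definition ext_i : extension := flip_i (adjoint4 (flip_i f)).
Definition ext_j : extension := flip_j (adjoint4 (flip_j f)).
Definition ext_r : extension := flip_r (adjoint4 (flip_r f)).
Definition ext_ts : extension := flip_s (adjoint4 (flip_t f)).
Definition ext_st : extension := flip_t (adjoint4 (flip_s f)).

Definition aron_berner_regular : Prop :=
  [/\ ext_i = ext_j, ext_j = ext_r, ext_r = ext_id, ext_id = ext_ts &
      ext_ts = ext_st].

End Regularity.
End Trilinear.

(* Main.v *)
(* Write XYZ for f^{****}, X being the outermost of the three iterated weak*
   limits that compute it; the other five extensions are the other orders, and
   those in (1), as well as those in (2), form an orbit under cyclic
   rotation.  A variable restricted to the canonical image of its space may be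
   moved to any place in the order.  So if XYZ = ZXY, restricting x'' to X shows
   that the limits in Y and Z commute for each x in X, whence XYZ = XZY for
   every x''.  Applied to the three rotations, this identifies each order of the
   orbit with one of the other orbit. *)
From HB Require Import structures.
Require Import Defs.
From mathcomp Require Import all_boot all_order all_algebra.
From mathcomp Require Import boolp topology reals normedtype.

Set Implicit Arguments.
Unset Strict Implicit.
Unset Printing Implicit Defensive.

Import Order.TTheory GRing.Theory Num.Theory.
Import numFieldNormedType.Exports.
Local Open Scope ring_scope.

Section CanonicalEmbedding.
Context {R : realType} {k : scalar_kind}.
Local Notation K := (scalar_field R k).
Variable E : normedModType K.

(** The estimate [|f x| <= |f| |x|] makes evaluation at [x] bounded on balls of the dual, hence
    continuous. *)
Lemma evaluation_subproof (x : E) :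
  (fun f : dual E => f x) \in @dual_pred R k (dual E).
Proof.
have lin : linear (fun f : dual E => f x : K^o) by [].
apply/asboolP; split => //.
pose L : {linear dual E -> K^o} := HB.pack (fun f : dual E => f x : K^o)
  (GRing.isLinear.Build K (dual E) K^o *:%R _ lin).
suff : continuous L by [].
apply/bounded_linear_continuous/bounded_funP => r; exists (r * `|x|) => f fr.
by rewrite (le_trans (ler_dual_norm f x))// ler_wpM2r.
Qed.

Definition evaluation (x : E) : bidual E := Dual (evaluation_subproof x).

End CanonicalEmbedding.

Section CyclicOrders.
Context {R : realType} {k : scalar_kind}.
Local Notation K := (scalar_field R k).

(** At [w], both sides are [a] applied to the functional whose value at [a0] is [c] of
    [w (g a0 b _)]: fixing [b] inside or outside [a] is the same. *)
Lemma adjoint4_evaluation_m (A B C D : normedModType K)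
    (g : bounded_trilinear A B C D) a b c :
  adjoint4 g a (evaluation b) c = adjoint4 (flip_i g) (evaluation b) a c.
Proof.
apply: dual_ext => w; congr (dual_fun a _); apply: dual_ext => a0.
by congr (dual_fun c _); apply: dual_ext.
Qed.

(** On both sides [a] acts outermost, on a functional whose value at [a0] is the extension at
    [evaluation a0]. *)
Lemma adjoint4_swap_r (A B C D : normedModType K)
    (g : bounded_trilinear A B C D) :
  (forall a b c,
     adjoint4 g (evaluation a) b c = adjoint4 (flip_j g) (evaluation a) c b) ->
  forall a b c, adjoint4 g a b c = adjoint4 (flip_j g) a c b.
Proof.
move=> gj a b c; apply: dual_ext => w; congr (dual_fun a _).
by apply: dual_ext => a0; exact: (congr1 (fun u : bidual D => u w) (gj a0 b c)).
Qed.

(** For an evaluation in A, the rotated order C, A, B may be read as A, C, B: moving A to the front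
    turns [flip_t g] into [flip_j g]. *)
Lemma adjoint4_rotation_swap (A B C D : normedModType K)
    (g : bounded_trilinear A B C D) :
  (forall a b c, adjoint4 g a b c = adjoint4 (flip_t g) c a b) ->
  forall a b c, adjoint4 g a b c = adjoint4 (flip_j g) a c b.
Proof.
move=> gt; apply: adjoint4_swap_r => a b c.
rewrite gt adjoint4_evaluation_m.
by congr (adjoint4 _ _ _ _); apply: bounded_trilinear_ext.
Qed.

Variables X Y Z W : normedModType K.

Lemma ext_ts_id_swap (f : bounded_trilinear X Y Z W) :
  ext_ts f = ext_id f -> ext_id f = ext_j f.
Proof.
move=> e; apply: bounded_trilinear_ext; apply: adjoint4_rotation_swap => x y z.
by rewrite -[LHS]/(ext_id f x y z) -e.
Qed.

Lemma cyclic_regular (f : bounded_trilinear X Y Z W) :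
  ext_ts f = ext_id f -> ext_id f = ext_st f ->
  [/\ ext_id f = ext_j f, ext_ts f = ext_r f & ext_st f = ext_i f].
Proof.
move=> ts_id id_st.
have tt : flip_t (flip_t f) = flip_s f by apply: bounded_trilinear_ext.
have ts : flip_t (flip_s f) = f by apply: bounded_trilinear_ext.
have tj : flip_j (flip_t f) = flip_r f by apply: bounded_trilinear_ext.
have sj : flip_j (flip_s f) = flip_i f by apply: bounded_trilinear_ext.
(* [flip_t] permutes [f], [flip_t f], [flip_s f] cyclically, so the swap also applies with Z, then
   Y, outermost. *)
have := @adjoint4_rotation_swap _ _ _ _ (flip_t f); rewrite tt tj => ts_r.
have := @adjoint4_rotation_swap _ _ _ _ (flip_s f); rewrite ts sj => st_i.
split; first exact: ext_ts_id_swap.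
- apply: bounded_trilinear_ext => x y z; apply: ts_r => c a b.
  exact: (congr1 (fun e : bounded_trilinear _ _ _ _ => e a b c)
    (etrans ts_id id_st)).
- apply: bounded_trilinear_ext => x y z; apply: st_i => b c a.
  exact: (congr1 (fun e : bounded_trilinear _ _ _ _ => e a b c) (esym id_st)).
Qed.

End CyclicOrders.

Theorem theorem2p1 (R : realType) (k : scalar_kind)
    (X Y Z W : normedModType (scalar_field R k))
    (f : bounded_trilinear X Y Z W) :
  (aron_berner_regular f <->
     ext_ts f = ext_id f /\ ext_id f = ext_st f) /\
  (aron_berner_regular f <->
     ext_i f = ext_j f /\ ext_j f = ext_r f).
Proof.
split; split.
- by case=> _ _ _ id_ts ts_st; split; [|rewrite id_ts].
- case=> ts_id id_st; have [id_j ts_r st_i] := cyclic_regular ts_id id_st.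
  by split; rewrite -?st_i -?id_j -?ts_r ?ts_id ?id_st.
- by case.
case=> i_j j_r.
(* Passing to [flip_j f] exchanges the two orbits: its extensions [ext_ts], [ext_id], [ext_st] are
   [ext_i f], [ext_j f], [ext_r f] with the last two arguments swapped. *)
have jj : flip_j (flip_j f) = f by apply: bounded_trilinear_ext.
have jt : flip_t (flip_j f) = flip_i f by apply: bounded_trilinear_ext.
have js : flip_s (flip_j f) = flip_r f by apply: bounded_trilinear_ext.
have ji : flip_i (flip_j f) = flip_t f by apply: bounded_trilinear_ext.
have jr : flip_r (flip_j f) = flip_s f by apply: bounded_trilinear_ext.
have [||j_id i_st r_ts] := @cyclic_regular _ _ _ _ _ _ (flip_j f).
- apply: bounded_trilinear_ext => x z y; rewrite /ext_ts /ext_id jt.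
  exact: (congr1 (fun e : bounded_trilinear _ _ _ _ => e x y z) i_j).
- apply: bounded_trilinear_ext => x z y; rewrite /ext_st /ext_id js.
  exact: (congr1 (fun e : bounded_trilinear _ _ _ _ => e x y z) j_r).
(* Swapping these arguments back turns the three conclusions into equalities for [f]. *)
have {}j_id : ext_j f = ext_id f.
  apply: bounded_trilinear_ext => x y z.
  have := congr1 (fun e : bounded_trilinear _ _ _ _ => e x z y) j_id.
  by rewrite /ext_j jj.
have {}i_st : ext_i f = ext_st f.
  apply: bounded_trilinear_ext => x y z.
  have := congr1 (fun e : bounded_trilinear _ _ _ _ => e x z y) i_st.
  by rewrite /ext_ts /ext_r jt jr.
have {}r_ts : ext_r f = ext_ts f.
  apply: bounded_trilinear_ext => x y z.
  have := congr1 (fun e : bounded_trilinear _ _ _ _ => e x z y) r_ts.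
  by rewrite /ext_st /ext_i js ji.
by split; rewrite // -?r_ts -?j_id -?i_st ?i_j ?j_r.
Qed.
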